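(* For every $n\in\mathbb{N}\cup\{\infty\}$ the free group $F(a,b)$ of rank two contains a malcharacteristic subgroup $L_n$ of rank $n$ (where $n=\infty$ means countably infinite rank).
   Context: Here $0\notin\mathbb{N}$. A subgroup $M$ of a group $H$ is malcharacteristic in $H$ if for all $\delta\in\operatorname{Aut}(H)$: $\delta(M)\cap M\neq 1$ implies $\delta\in\operatorname{Inn}(M):=\{\gamma_h:h\in M\}$, where $\gamma_h(g)=h^{-1}gh$ for $g\in H$. *)

(* Defs.v *)
From HB Require Import structures.
From mathcomp Require Import all_boot.
From mathcomp Require Import boolp classical_sets functions.

Set Implicit Arguments.
Unset Strict Implicit.
Unset Printing Implicit Defensive.

Local Open Scope classical_set_scope.
Local Open Scope group_scope.

Section ReducedWords.
Variable T : choiceType.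

(* The letter (t, false) stands for t and (t, true) for its inverse t^-1. *)
Definition letter := (T * bool)%type.
Implicit Types (x y : letter) (u v w : seq letter).

Definition letter_inv x : letter := (x.1, ~~ x.2).

Definition reduced w := sorted (fun x y => y != letter_inv x) w.

(* Left multiplication of a reduced word by a letter, with cancellation. *)
Definition push x w :=
  if w is y :: w' then if y == letter_inv x then w' else x :: w else [:: x].

Definition word_mul u v := foldr push v u.

Definition word_inv w := rev (map letter_inv w).

Lemma letter_invK : involutive letter_inv.
Proof. by case=> t b; rewrite /letter_inv /= negbK. Qed.

Lemma reduced_behead x w : reduced (x :: w) -> reduced w.
Proof. by case: w => //= y w /andP[]. Qed.

Lemma push_reduced x w : reduced w -> reduced (push x w).
Proof.
case: w => //= y w; case: eqP => [_ /(@reduced_behead y) //|/eqP yx yw] /=.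
by rewrite yx.
Qed.

Lemma word_mul_reduced u v : reduced v -> reduced (word_mul u v).
Proof. by move=> rv; elim: u => //= x u; apply: push_reduced. Qed.

Lemma pushK x w : reduced w -> push x (push (letter_inv x) w) = w.
Proof.
case: w => [|y w] /=; first by rewrite eqxx.
rewrite letter_invK; case: eqP => [->|yx _] /=; last by rewrite eqxx.
by case: w => //= z w /andP[/negPf->].
Qed.

Lemma pushVK x w : reduced w -> push (letter_inv x) (push x w) = w.
Proof. by move=> rw; have := pushK (letter_inv x) rw; rewrite letter_invK. Qed.

Lemma word_mul_push x u v : reduced v ->
  word_mul (push x u) v = push x (word_mul u v).
Proof.
case: u => //= y u rv; case: eqP => //= ->.
by rewrite pushK //; apply: word_mul_reduced.
Qed.

Lemma word_mulA u v w : reduced w ->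
  word_mul u (word_mul v w) = word_mul (word_mul u v) w.
Proof. by move=> rw; elim: u => //= x u ->; rewrite word_mul_push. Qed.

Lemma word_mulw1 w : reduced w -> word_mul w [::] = w.
Proof.
elim: w => //= x w IHw xw; rewrite IHw; last exact: reduced_behead xw.
by case: w xw {IHw} => //= y w /andP[/negPf->].
Qed.

Lemma word_mulVw u v : reduced v ->
  word_mul (word_inv u) (word_mul u v) = v.
Proof.
move=> rv; elim: u => //= x u IHu.
rewrite /word_inv /= rev_cons -cats1 /word_mul foldr_cat /=.
by rewrite pushVK //; apply: word_mul_reduced.
Qed.

Lemma word_inv_reduced w : reduced w -> reduced (word_inv w).
Proof.
rewrite /reduced /word_inv rev_sorted sorted_map => rw.
apply: sub_sorted rw => x y /=; apply: contraNN => /eqP.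
by rewrite letter_invK => ->.
Qed.

End ReducedWords.

Section FreeGroup.
Variable T : choiceType.

Record free_group := FreeGroup {
  word_of : seq (letter T);
  word_ofP : reduced word_of
}.

HB.instance Definition _ := [isSub for word_of].
HB.instance Definition _ := [Choice of free_group by <:].

Definition free_one := @FreeGroup [::] isT.
Definition free_mul (u v : free_group) :=
  FreeGroup (word_mul_reduced (word_of u) (word_ofP v)).
Definition free_inv (u : free_group) := FreeGroup (word_inv_reduced (word_ofP u)).

Fact free_mulA : associative free_mul.
Proof. by move=> u v w; apply: val_inj; apply: word_mulA (word_ofP w). Qed.
Fact free_mul1 : left_id free_one free_mul.
Proof. by move=> u; apply: val_inj. Qed.
Fact free_mulr1 : right_id free_one free_mul.
Proof. by move=> u; apply: val_inj; apply: word_mulw1 (word_ofP u). Qed.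
Fact free_mulV : left_inverse free_one free_inv free_mul.
Proof.
move=> u; apply: val_inj => /=.
by rewrite -[in X in word_mul _ X](word_mulw1 (word_ofP u)) word_mulVw.
Qed.
Fact free_mulrV : right_inverse free_one free_inv free_mul.
Proof.
move=> u; have e : free_inv (free_inv u) = u.
  apply: val_inj; rewrite /= /word_inv map_rev revK -map_comp.
  by rewrite map_id_in // => x _; apply: letter_invK.
by rewrite -{1}e free_mulV.
Qed.

HB.instance Definition _ := isGroup.Build free_group
  free_mulA free_mul1 free_mulr1 free_mulV free_mulrV.

Definition free_gen (t : T) : free_group := @FreeGroup [:: (t, false)] isT.

Section Lift.
Variables (G : groupType) (f : T -> G).

Definition letter_eval (x : letter T) : G := if x.2 then (f x.1)^-1 else f x.1.

(* The homomorphism extending f: it substitutes f t for each generator t. *)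
Definition free_lift (u : free_group) : G := \prod_(x <- word_of u) letter_eval x.

Fact letter_evalV x : letter_eval (letter_inv x) = (letter_eval x)^-1.
Proof. by case: x => t [] //=; rewrite /letter_eval /= invgK. Qed.

Fact free_lift_morph : {morph free_lift : u v / u * v}.
Proof.
case=> [u ru] [v rv]; rewrite /free_lift /=.
elim: u {ru} => [|x u IHu]; first by rewrite big_nil mul1g.
rewrite /= big_cons -mulgA -IHu; case: (word_mul u v) => [|y w] /=.
  by rewrite big_cons.
by case: eqP => [->|_]; rewrite !big_cons // letter_evalV mulVKg.
Qed.

Fact free_lift1 : free_lift 1 = 1.
Proof. exact: big_nil. Qed.

HB.instance Definition _ := isUMagmaMorphism.Build free_group G free_lift
  (free_lift1, free_lift_morph).

Lemma free_lift_gen t : free_lift (free_gen t) = f t.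
Proof. by rewrite /free_lift /= big_seq1. Qed.

End Lift.

Lemma free_lift_unique (G : groupType) (f : T -> G)
    (h : UMagmaMorphism.type free_group G) :
  (forall t, h (free_gen t) = f t) -> h =1 free_lift f.
Proof.
move=> hf; have hx (x : letter T) (rx : reduced [:: x]) :
    h (FreeGroup rx) = letter_eval f x.
  case: x rx => t b rx; rewrite /letter_eval /= -hf.
  case: b rx => rx; last by congr (h _); apply: val_inj.
  by rewrite -gmulfV; congr (h _); apply: val_inj.
case=> w; elim: w => [|x w IHw] rw.
  rewrite /free_lift big_nil -[RHS](@gmulf1 _ _ h); congr (h _); exact: val_inj.
have rw' : reduced w by apply: reduced_behead rw.
have -> : FreeGroup rw = @FreeGroup [:: x] isT * FreeGroup rw'.
  apply: val_inj => /=.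
  by case: w rw {IHw rw'} => //= y w /andP[/negPf->].
by rewrite gmulfM free_lift_morph hx IHw {2}/free_lift /= big_seq1.
Qed.

End FreeGroup.

Definition subgroup (G : groupType) (M : set G) : Prop :=
  group_closed [in M].

Definition automorphism (G : groupType) (d : UMagmaMorphism.type G G) : Prop :=
  bijective d.

(* With the library's convention g ^ h = h^-1 * (g * h). *)
Definition Inn (G : groupType) (M : set G) : set (G -> G) :=
  [set conjg^~ h | h in M].

Definition malcharacteristic (H : groupType) (M : set H) : Prop :=
  subgroup M /\
  forall d : UMagmaMorphism.type H H, automorphism d ->
    d @` M `&` M <> [set 1] -> Inn M d.

(* The family x freely generates the subgroup L; in particular, x is
   injective. *)
Definition free_basis (I : choiceType) (G : groupType) (x : I -> G)
    (L : set G) : Prop :=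
  set_bij [set: free_group I] L (free_lift x).

(* The subgroup L is free on a basis of n elements, where n = None stands for
   countably infinite rank. *)
Definition has_rank (G : groupType) (L : set G) (n : option nat) : Prop :=
  if n is Some k then exists x : 'I_k -> G, free_basis x L
  else exists x : nat -> G, free_basis x L.

(* The free group F(a, b), with a = free_gen false and b = free_gen true. *)
Definition F2 : groupType := free_group bool.

(* Main.v *)
Require Import Defs.
From mathcomp Require Import all_boot.
From mathcomp Require Import boolp classical_sets functions.
From mathcomp Require Import zify.

(** If M is malcharacteristic in H and K is malnormal in M, then K is
    malcharacteristic in H: an automorphism that sends some nontrivial element
    of K into K is conjugation by an element h of M, and h lies in K by
    malnormality.  So one malcharacteristic subgroup of rank two is enough, as
    the free group of rank two has malnormal free subgroups of every countable
    rank.  The first is the image of the injective endomorphism [Theta], the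
    others are the images of the embeddings [psi].

    Automorphisms.  By Nielsen reduction ([standard_of_surj]) every
    automorphism of F(a, b) is, up to conjugation, a product of the swap of a
    and b and of tau : a -> ab, b -> b, preceded and followed by a signed
    permutation of the letters.  For a cyclically reduced word let x and y be
    the numbers of letters a and b (with either exponent), let c be the number
    of cyclically consecutive pairs of letters whose exponents have the same
    sign, and let c' be the analogue of c after replacing b by its inverse.
    Then c + c' >= 2 max(x, y) ([cyc_turns]), and tau turns (x, y, c') into
    (x, c, y).  (These are the intersection numbers of a curve on the
    once-punctured torus with the arcs of an ideal triangulation, and tau is a
    flip.)  It follows that c' < max(x, y) is preserved by tau, and that tau
    lengthens such a word ([positive_grow]); the strict inequality
    c > max(x, y) is enough to get started ([positive_grow_strict]).  Hence a
    word which satisfies c > max(x, y) after every signed permutation is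
    strictly lengthened by all automorphisms other than the signed permutations
    composed with conjugations ([standard_dichotomy]).  Every nontrivial element
    of the image of [Theta] is conjugate in this image to such a word.
    If an automorphism maps one such word to a conjugate of another, then
    neither it nor its inverse can lengthen, so it is a signed permutation
    up to conjugation.

    Synchronization.  If g conjugates a cyclically reduced word to another one,
    then high powers of the two words overlap along a long subword, and the
    position of the overlap determines g ([pow_overlap]).  The values of [Theta]
    on a and b have length 9, and no signed permutation of one of them or of its
    inverse occurs in a product of two of these blocks, unless it is a block in
    its place ([block_sync]).  So the signed permutation above is trivial
    and the conjugating element lies in the image of [Theta] ([Theta_mal]).
    The embedding [psi] sends the i-th generator to the product
    a^m b a^-n with m and n distinct powers of 3; as the
    difference of two distinct powers of 3 determines both, the exponent of a
    single power of a between two letters b determines the two neighbouring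
    generators, and the same overlap argument gives malnormality
    ([psi_malnormal]). *)

Set Implicit Arguments.
Unset Strict Implicit.
Unset Printing Implicit Defensive.

Local Open Scope group_scope.


(** * Words and free groups *)

Section Words.
Variable T : choiceType.
Implicit Types (x y : letter T) (s t w c : seq (letter T)) (u v g : free_group T).

Definition compat x y := y != letter_inv x.

Definition cyc_reduced w := cycle compat w.

(** The group element of a word that need not be reduced; on reduced words it is
    inverse to [word_of]. *)
Definition ev w : free_group T := \prod_(x <- w) letter_eval (@free_gen T) x.

Definition pow n w := flatten (nseq n w).

Lemma ev_nil : ev [::] = 1. Proof. exact: big_nil. Qed.

Lemma ev_cons x w : ev (x :: w) = ev [:: x] * ev w.
Proof. by rewrite /ev big_cons big_seq1. Qed.

Lemma ev_cat s t : ev (s ++ t) = ev s * ev t.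
Proof. exact: big_cat. Qed.

Lemma word_of_ev1 x : word_of (ev [:: x]) = [:: x].
Proof. by rewrite /ev big_seq1 /letter_eval; case: x => a []. Qed.

Lemma word_of_ev w : reduced w -> word_of (ev w) = w.
Proof.
elim: w => [|x w IHw] rw; first by rewrite ev_nil.
rewrite ev_cons /= word_of_ev1 IHw /=; last exact: reduced_behead rw.
by case: w rw {IHw} => //= y w /andP[/negPf ->].
Qed.

Lemma word_ofK u : ev (word_of u) = u.
Proof. by apply: val_inj; apply: word_of_ev; apply: word_ofP. Qed.

Lemma ev_letter_inv x : ev [:: letter_inv x] = (ev [:: x])^-1.
Proof. by rewrite /ev !big_seq1 letter_evalV. Qed.

Lemma word_inv_cat s t : word_inv (s ++ t) = word_inv t ++ word_inv s.
Proof. by rewrite /word_inv map_cat rev_cat. Qed.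

Lemma size_word_inv s : size (word_inv s) = size s.
Proof. by rewrite size_rev size_map. Qed.

Lemma ev_word_inv w : ev (word_inv w) = (ev w)^-1.
Proof.
elim: w => [|x w IHw]; first by rewrite ev_nil invg1.
by rewrite -cat1s word_inv_cat !ev_cat invgM IHw ev_letter_inv.
Qed.

Lemma word_of_inv u : word_of u^-1 = word_inv (word_of u).
Proof. by []. Qed.

Lemma ev_pow n w : ev (pow n w) = ev w ^+ n.
Proof. by elim: n => [|n IHn]; rewrite ?ev_nil //= ev_cat IHn expgS. Qed.

Lemma powD m n w : pow (m + n) w = pow m w ++ pow n w.
Proof. by rewrite /pow nseqD flatten_cat. Qed.

Lemma size_pow n w : size (pow n w) = (n * size w)%N.
Proof. by elim: n => //= n IHn; rewrite size_cat IHn mulSn. Qed.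

Lemma reduced_cat s t : reduced (s ++ t) -> reduced s /\ reduced t.
Proof. by case/cat_sorted2. Qed.

Lemma reduced_pow n w : cyc_reduced w -> reduced (pow n w).
Proof.
case: w => [_|x s]; first by elim: n.
rewrite /cyc_reduced /= rcons_path => /andP[ps cl].
suff: path compat (last x s) (pow n (x :: s)) by apply: path_sorted.
by elim: n => //= n IHn; rewrite cat_path ps IHn cl.
Qed.

Lemma cyc_reduced_reduced w : cyc_reduced w -> reduced w.
Proof. by move=> /(@reduced_pow 1); rewrite /pow /= cats0. Qed.

(** All the cancellation in a product takes place in one piece Q at the junction. *)
Lemma mul_split u v : exists P Q R,
  [/\ word_of u = P ++ Q, word_of v = word_inv Q ++ R
    & word_of (u * v) = P ++ R].
Proof.
case: u => s /=; rewrite /=; elim: s => [|x s IHs] /= rs.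
  by exists [::], [::], (word_of v).
have [P [Q [R [es ev' em]]]] := IHs (reduced_behead rs).
have {}em : word_mul s (word_of v) = P ++ R := em.
rewrite em; move: rs; rewrite /= in es *; rewrite es.
case: P em {es} => [|y P] em /= rs; last first.
  exists [:: x, y & P], Q, R; split=> //=.
  by move: rs => /andP[/negPf-> _].
case: R ev' em => [|y R] ev' em /=.
  by exists [:: x], Q, [::].
case: eqP => [e|_]; last by exists [:: x], Q, (y :: R).
exists [::], (x :: Q), R; split=> //.
by rewrite -cat1s word_inv_cat -catA ev' e.
Qed.

Lemma size_mul u v : size (word_of (u * v)) <= size (word_of u) + size (word_of v).
Proof.
have [P [Q [R [-> -> ->]]]] := mul_split u v.
rewrite !size_cat; lia.
Qed.

Lemma size_ev w : size (word_of (ev w)) <= size w.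
Proof.
elim: w => [|x w IHw]; first by rewrite ev_nil.
rewrite ev_cons; apply: leq_trans (size_mul _ _) _.
by rewrite word_of_ev1 /= add1n ltnS.
Qed.

Lemma reduced_glue s x t w :
  reduced (s ++ x :: t) -> reduced (x :: t ++ w) -> reduced (s ++ x :: t ++ w).
Proof.
rewrite /reduced; case: s => //= y s; rewrite !cat_path /= => /and3P[-> -> _].
by rewrite cat_path.
Qed.

Lemma cyc_of_path x w : path compat (last x w) w -> cyc_reduced w.
Proof.
by case: w => //= y w /andP[yw pw]; rewrite /cyc_reduced /= rcons_path pw.
Qed.

Lemma mul_suffix u v : exists h j,
  j <= size (word_of u) /\ word_of (u * v) = h ++ drop j (word_of v).
Proof.
have [P [Q [R [-> -> ->]]]] := mul_split u v.
exists P, (size Q); split; first by rewrite size_cat leq_addl.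
by rewrite drop_size_cat ?size_word_inv.
Qed.

Lemma mul_prefix u v : exists h j,
  j <= size (word_of v) /\
  word_of (u * v) = take (size (word_of u) - j) (word_of u) ++ h.
Proof.
have [P [Q [R [-> -> ->]]]] := mul_split u v.
exists R, (size Q); split; first by rewrite size_cat size_word_inv leq_addr.
by rewrite size_cat addnK take_size_cat.
Qed.

Lemma size_conj u g :
  size (word_of (u ^ g)) <= size (word_of u) + (2 * size (word_of g))%N.
Proof.
apply: leq_trans (size_mul _ _) _; rewrite word_of_inv size_word_inv.
rewrite mul2n -addnn addnCA leq_add2l; exact: size_mul.
Qed.

(** Otherwise the k-th powers, whose lengths are k times larger, would have
    lengths further apart than the 2|g| letters that conjugation by g can add. *)
Lemma conj_size_le w w' g : cyc_reduced w -> cyc_reduced w' ->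
  ev w ^ g = ev w' -> size w' <= size w.
Proof.
move=> cw cw' e; rewrite leqNgt; apply/negP => lt.
pose k := (2 * size (word_of g))%N.+1.
have := size_conj (ev (pow k w)) g.
rewrite ev_pow conjXg e -!ev_pow !word_of_ev ?reduced_pow // !size_pow.
have : (k * (size w).+1 <= k * size w')%N by rewrite leq_mul.
rewrite /k; lia.
Qed.

Lemma conj_size w w' g : cyc_reduced w -> cyc_reduced w' ->
  ev w ^ g = ev w' -> size w' = size w.
Proof.
move=> cw cw' e; apply/eqP; rewrite eqn_leq (conj_size_le cw cw' e) /=.
by apply: (@conj_size_le _ _ g^-1) => //; rewrite -e conjgK.
Qed.

(** Conjugation by g only alters the ends of a high power of w, so a middle part
    [pow r w] of it survives as a subword of a power of w'.  The second conclusion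
    records where: the conjugator sends the prefix of the power of w before this
    part to the prefix A of the power of w'.  Thus g is known once A is. *)
Lemma pow_overlap w w' g r : w != [::] -> cyc_reduced w -> cyc_reduced w' ->
  ev w ^ g = ev w' ->
  exists i k A B, pow k w' = A ++ pow r w ++ B /\ g^-1 * ev w ^+ i = ev A.
Proof.
move=> w0 cw cw' e; pose n := size (word_of g).
have nle : n <= size (pow n w).
  by rewrite size_pow leq_pmulr // lt0n size_eq0.
pose k := n + (r + n).
have [h [j [jle hj]]] := mul_suffix g^-1 (ev (pow k w)).
rewrite word_of_inv size_word_inv -/n in jle.
rewrite (@word_of_ev (pow _ _)) ?reduced_pow // in hj.
have [h' [j' [jle' hj']]] := mul_prefix (g^-1 * ev (pow k w)) g.
rewrite -/n in jle'.
have wk : word_of (g^-1 * ev (pow k w) * g) = pow k w'.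
  by rewrite -mulgA -conjgE ev_pow conjXg e -ev_pow word_of_ev ?reduced_pow.
pose A := h ++ drop j (pow n w).
have hA : word_of (g^-1 * ev (pow k w)) = A ++ (pow r w ++ pow n w).
  rewrite hj /k powD powD /A -catA; congr (_ ++ _).
  rewrite drop_cat; case: ltnP => // nj; rewrite (drop_oversize nj).
  by rewrite (_ : j - _ = 0)%N ?drop0 //; apply/eqP; rewrite subn_eq0 (leq_trans jle).
exists n, k, A.
exists (take (size (pow n w) - j') (pow n w) ++ h'); split.
  rewrite -wk hj' hA !size_cat.
  rewrite take_cat ifF; last by apply/negbTE; rewrite -leqNgt /A size_cat; lia.
  rewrite take_cat ifF; last by apply/negbTE; rewrite -leqNgt /A size_cat; lia.
  rewrite -!catA.
  by do 3!congr (_ ++ _); congr (_ ++ _); congr take; rewrite /A size_cat; lia.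
(* Both sides times this tail are the unconjugated product, by hA. *)
apply: (mulIg (ev (pow r w ++ pow n w))).
by rewrite -ev_cat -hA word_ofK -ev_pow -mulgA -ev_cat /k !powD.
Qed.

(** Strip the first and the last letter as long as they are inverse to each other. *)
Lemma cyc_decomp u : exists t c,
  cyc_reduced c /\ word_of u = word_inv t ++ c ++ t.
Proof.
have [n] := ubnP (size (word_of u)); elim: n u => // n IHn u; rewrite ltnS => szn.
case: (boolP (cyc_reduced (word_of u))) => [cu|].
  by exists [::], (word_of u); rewrite cats0.
case eu: (word_of u) => [|x s] //.
have := word_ofP u; rewrite eu /cyc_reduced /= rcons_path.
move=> rs; rewrite [path _ _ _]rs /= negbK => /eqP ex.
case: (lastP s) ex eu rs => [|m y] ex eu rs.
  by move: ex => /=; case: (x) => a [].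
rewrite last_rcons in ex.
have rm : reduced m.
  have := path_sorted rs; rewrite -cats1 => /cat_sorted2[]; done.
have [|t [c [cc em]]] := IHn (ev m).
  by rewrite word_of_ev //; move: szn; rewrite eu /= size_rcons; lia.
rewrite word_of_ev // in em.
exists (rcons t y), c; split=> //.
by rewrite em -!cats1 word_inv_cat /= ex -!catA.
Qed.

Lemma cyc_decomp_conj u : exists g c, cyc_reduced c /\ u = ev c ^ g.
Proof.
have [t [c [cc e]]] := cyc_decomp u.
by exists (ev t), c; rewrite -[u]word_ofK e !ev_cat ev_word_inv.
Qed.

(** A nontrivial element conjugates to a cyclically reduced word, which is not
    shortened at all by squaring. *)
Lemma size_sq u : u != 1 -> size (word_of u) < size (word_of (u * u)).
Proof.
have [t [c [cc e]]] := cyc_decomp u => u1.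
have c0 : c != [::].
  apply: contraNneq u1 => c0.
  by rewrite -[u]word_ofK e c0 !ev_cat ev_word_inv ev_nil mul1g mulVg.
have rw : sorted compat (word_inv t ++ (c ++ c) ++ t).
  have : sorted compat (word_inv t ++ c ++ t) by rewrite -e; apply: word_ofP.
  have : sorted compat (c ++ c).
    by have := @reduced_pow 2 c cc; rewrite /pow /= cats0.
  case: (c) c0 => // x s _.
  rewrite /= cat_path /= => /and3P[ps cs _].
  case: (word_inv t) => [|y r]; rewrite /= !cat_path /= ?cat_path /= ?last_cat /=.
    by rewrite ps cs => /= ->.
  by rewrite ps cs => /and4P[-> -> _ ->].
have -> : word_of (u * u) = word_inv t ++ (c ++ c) ++ t.
  rewrite -[RHS]word_of_ev // -[u]word_ofK e !ev_cat ev_word_inv; congr word_of.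
  by rewrite !mulgA mulgK.
have c1 : 0 < size c by rewrite lt0n size_eq0.
rewrite e !size_cat; lia.
Qed.

Variables (G : groupType).

Lemma lift_ev (f : T -> G) w : free_lift f (ev w) = \prod_(x <- w) letter_eval f x.
Proof.
elim: w => [|x w IHw]; first by rewrite ev_nil free_lift1 big_nil.
rewrite ev_cons free_lift_morph IHw big_cons; congr (_ * _).
by rewrite /free_lift word_of_ev1 big_seq1.
Qed.

Definition morph (d : free_group T -> G) := {morph d : x y / x * y}.

Lemma morph1 d : morph d -> d 1 = 1.
Proof. by move=> md; apply: (mulgI (d 1)); rewrite -md !mulg1. Qed.

Lemma morphV d : morph d -> {morph d : x / x^-1}.
Proof.
move=> md x; apply: (mulgI (d x)).
by rewrite -md !mulgV morph1.
Qed.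

Lemma morphX d n : morph d -> {morph d : x / x ^+ n}.
Proof.
by move=> md x; elim: n => [|n IHn]; rewrite ?(morph1 md) // !expgS md IHn.
Qed.

Lemma morph_conjg d u v : morph d -> d (u ^ v) = d u ^ d v.
Proof. by move=> md; rewrite !conjgE !md morphV. Qed.

Lemma morph_ext d d' : morph d -> morph d' ->
  (forall a, d (free_gen a) = d' (free_gen a)) -> d =1 d'.
Proof.
move=> md md' e u; rewrite -[u]word_ofK; elim: (word_of u) => [|x w IHw].
  by rewrite ev_nil !morph1.
rewrite ev_cons md md' IHw; congr (_ * _); rewrite /ev big_seq1.
by case: x => a [] /=; rewrite /letter_eval /= ?morphV // e.
Qed.

End Words.
Arguments compat {T} x y.

(** * Positive automorphisms lengthen cyclic words *)

Section SignedPermutations.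

(** The triple (s, (f, f')) exchanges a and b if s holds, and inverts the image of
    a if f holds and that of b if f' holds. *)
Definition sperm_letter (p : bool * (bool * bool)) (x : letter bool) : letter bool :=
  (x.1 (+) p.1, x.2 (+) (if x.1 then p.2.2 else p.2.1)).

Definition sperm p : F2 -> F2 := free_lift (fun t => ev [:: sperm_letter p (t, false)]).

Definition swap := (true, (false, false)).

Lemma sperm_letter_inv p x :
  sperm_letter p (letter_inv x) = letter_inv (sperm_letter p x).
Proof. by case: p => [[] [[] []]]; case: x => [[] []]. Qed.

Lemma sperm_letter_inj p : injective (sperm_letter p).
Proof. by case: p => [[] [[] []]] [[] []] [[] []]. Qed.

Lemma exists_sperm x y : x.1 != y.1 ->
  exists p, sperm_letter p (false, false) = x /\ sperm_letter p (true, false) = y.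
Proof.
move=> xy; exists (x.1, (x.2, y.2)).
by case: x xy => [[] []]; case: y => [[] []].
Qed.

Lemma sperm_morph p : morph (sperm p). Proof. exact: free_lift_morph. Qed.

Lemma sperm_ev p w : sperm p (ev w) = ev (map (sperm_letter p) w).
Proof.
rewrite /sperm lift_ev /ev big_map; apply: eq_bigr => -[t s] _.
case: p => [sw [f0 f1]]; case: s; case: t; rewrite /letter_eval /ev /= big_seq1 /letter_eval /=.
- by case: f1; rewrite ?invgK.
- by case: f0; rewrite ?invgK.
- by case: f1.
- by case: f0.
Qed.

Lemma sperm_cyc p w : cyc_reduced (map (sperm_letter p) w) = cyc_reduced w.
Proof.
rewrite /cyc_reduced cycle_map; apply: eq_cycle => x y /=.
by rewrite /compat -sperm_letter_inv (inj_eq (@sperm_letter_inj p)).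
Qed.

End SignedPermutations.

Section Growth.
Implicit Types (x y p q r e : letter bool) (s t w : seq (letter bool)).

Definition tau : F2 -> F2 :=
  free_lift (fun b : bool => if b then free_gen true else free_gen false * free_gen true).

Lemma tau_morph : morph tau. Proof. exact: free_lift_morph. Qed.

(** The head of the list acts first, so that precomposition adds or removes a head. *)
Fixpoint positive (l : seq bool) (u : F2) : F2 :=
  if l is c :: l' then positive l' (if c then tau u else sperm swap u) else u.

Lemma positive_morph l : morph (positive l).
Proof.
elim: l => // c l IHl u v /=.
by case: c; rewrite -IHl ?tau_morph ?sperm_morph.
Qed.

(** [same] compares the signs of two exponents, and [same_flip] does so after b is
    replaced by its inverse.  For a cyclic word their counts [ccount] are the
    numbers of letters b that appear after substituting ab, respectively ab^-1,
    for a. *)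
Definition same x y := x.2 == y.2.
Definition same_flip x y := x.1 (+) x.2 == y.1 (+) y.2.
Definition count_a w := count (fun x : letter bool => ~~ x.1) w.
Definition count_b w := count (fun x : letter bool => x.1) w.

Fixpoint pcount (f : rel (letter bool)) x s : nat :=
  if s is y :: s' then f x y + pcount f y s' else 0.

Definition ccount f w := if w is x :: s then pcount f x (rcons s x) else 0.

Lemma count_a_b w : count_a w + count_b w = size w.
Proof. by rewrite addnC; apply: count_predC. Qed.

Lemma pcount_rcons f x s y : pcount f x (rcons s y) = pcount f x s + f (last x s) y.
Proof. by elim: s x => [|z s IHs] x /=; rewrite ?addn0 // IHs addnA. Qed.

Lemma path_turns (P : pred (letter bool)) x s :
  (forall p q, compat p q -> P p + P q <= same p q + same_flip p q) ->
  path compat x s ->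
  2 * count P (x :: s) <= pcount same x s + pcount same_flip x s + P x + P (last x s).
Proof.
move=> hP; elim: s x => [|y s IHs] x /=; first by case: (P x).
move=> /andP[/hP h1 /IHs /=]; lia.
Qed.

(** Add over all cyclically consecutive pairs: a pair aa or bb (or its inverse) is
    counted by both relations, and a pair of different generators by exactly
    one of them. *)
Lemma cyc_turns w : cyc_reduced w ->
  2 * maxn (count_a w) (count_b w) <= ccount same w + ccount same_flip w.
Proof.
case: w => // x s cw.
have ha := @path_turns (fun x => ~~ x.1) _ _ _ cw.
have hb := @path_turns (fun x => x.1) _ _ _ cw.
have {}/ha : forall p q, compat p q -> ~~ p.1 + ~~ q.1 <= same p q + same_flip p q.
  by move=> [[] []] [[] []].
have {}/hb : forall p q, compat p q -> p.1 + q.1 <= same p q + same_flip p q.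
  by move=> [[] []] [[] []].
rewrite last_rcons -rcons_cons -cats1 /count_a /count_b /ccount !count_cat /=.
lia.
Qed.

(** Giving half of every letter b to each of its two neighbouring gaps, tau puts
    one b^s in each gap between letters of exponent s and nothing in the gaps
    where the sign changes, while the letters a stay.  So the image of a cyclic
    word is read off locally, already reduced.  [tau_out p q] is what the letter
    p and the gap between p and q contribute. *)
Definition tau_out p q : seq (letter bool) :=
  (if p.1 then [::] else [:: p]) ++ (if same p q then [:: (true, p.2)] else [::]).

Fixpoint tau_path p s := if s is q :: s' then tau_out p q ++ tau_path q s' else [::].

Definition tau_cyc w := if w is x :: s then tau_path x (rcons s x) else [::].

Lemma count_a_tau_path p s : count_a (tau_path p s) = count_a (belast p s).
Proof.
elim: s p => //= q s IHs p; have := IHs q; rewrite /count_a /tau_out !count_cat => ->.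
by case: p => [[] sg] /=; case: same.
Qed.

Lemma count_b_tau_path p s : count_b (tau_path p s) = pcount same p s.
Proof.
elim: s p => //= q s IHs p; have := IHs q; rewrite /count_b /tau_out !count_cat => ->.
by case: p => [[] sg] /=; case: same.
Qed.

(** The halves of the letter b are shifted by half a letter, to get integral
    exponents; this is the resulting correction at the ends of a word. *)
Definition tau_offset x : F2 := if x.2 then (free_gen true)^-1 else 1.

Lemma tau_path_ev p s :
  tau (ev (belast p s)) = tau_offset p * ev (tau_path p s) * (tau_offset (last p s))^-1.
Proof.
elim: s p => [|q s IHs] p /=.
  by rewrite ev_nil mulg1 mulgV /tau free_lift1.
rewrite ev_cons tau_morph IHs ev_cat !mulgA; do 2!congr (_ * _).
rewrite /tau lift_ev big_seq1 /tau_out /same /tau_offset /ev.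
case: p => [[] []]; case: q => [? []];
  rewrite ?big_cons ?big_nil /letter_eval /= ?mulg1 ?mul1g ?mulgV ?mulVg
    ?invgM ?mulgK ?mulgVK ?invgK //.
by rewrite mulgA.
Qed.

(** The possible last letters e of the output when the gap between p and q has
    just been treated.  The output may then end with a letter coming from an
    earlier gap, whence the alternative in the middle case. *)
Definition may_precede e p q :=
  if same p q then e == (true, p.2)
  else if p.1 then (e == (true, p.2)) || (e == (false, ~~ p.2)) else e == p.

(** A letter b before a change of sign produces its pair counted by [same_flip]
    only when the next letter is output. *)
Definition pending p q := p.1 && ~~ same p q.

Fixpoint last_pair p q s := if s is r :: s' then last_pair q r s' else (p, q).

(** A finite case analysis, over the four letters involved. *)
Lemma tau_path_step e p q r : compat p q -> compat q r -> may_precede e p q ->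
  [/\ path compat e (tau_out q r), may_precede (last e (tau_out q r)) q r
   & pcount same_flip e (tau_out q r) + pending q r = pending p q + q.1].
Proof.
by case: e => [[] []]; case: p => [[] []]; case: q => [[] []]; case: r => [[] []].
Qed.

Lemma pcount_cat f x s t :
  pcount f x (s ++ t) = pcount f x s + pcount f (last x s) t.
Proof. by elim: s x => //= y s IHs x; rewrite IHs addnA. Qed.

Lemma path_tau_path e p q s : path compat p (q :: s) -> may_precede e p q ->
  let l := last_pair p q s in
  [/\ path compat e (tau_path q s), may_precede (last e (tau_path q s)) l.1 l.2
    & pcount same_flip e (tau_path q s) + pending l.1 l.2 = pending p q + count_b (belast q s)].
Proof.
elim: s e p q => [|r s IHs] e p q /=; first by rewrite addn0.
move=> /and3P[pq qr prs] he.
have [h1 h2 h3] := tau_path_step pq qr he.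
have [|i1 i2 i3] := IHs (last e (tau_out q r)) q r _ h2; first by rewrite /= qr.
rewrite cat_path h1 i1 last_cat pcount_cat; split=> //.
move: h3 i3; rewrite /count_b /=; lia.
Qed.

Lemma last_pair_rcons p q s x : last_pair p q (rcons s x) = (last q s, x).
Proof. by elim: s p q => //= r s IHs p q; rewrite IHs. Qed.

(** [path_tau_path] is used twice around the cycle, first from an arbitrary
    admissible last letter, then from the one found at the end of the first turn,
    which is the true predecessor of the first letter.  The two pending terms
    are equal and cancel. *)
Lemma cyc_tau_cyc w : cyc_reduced w ->
  cyc_reduced (tau_cyc w) /\ ccount same_flip (tau_cyc w) = count_b w.
Proof.
case: w => // x s cw; set t := tau_cyc _.
have pw : path compat (last x s) (x :: rcons s x).
  by move: (cw); rewrite /cyc_reduced /= rcons_path => /andP[ps cl]; rewrite cl ps.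
have H e : may_precede e (last x s) x ->
    [/\ path compat e t, may_precede (last e t) (last x s) x & pcount same_flip e t = count_b (x :: s)].
  move=> /(path_tau_path pw); rewrite last_pair_rcons /= -/t => -[-> -> h]; split=> //.
  by move: h; rewrite belast_rcons addnC; apply: addnI.
have [e0 he0] : exists e, may_precede e (last x s) x.
  exists (if same (last x s) x || (last x s).1 then (true, (last x s).2) else last x s).
  by rewrite /may_precede; case: (same _ _); case: ((last x s).1) => /=; rewrite eqxx.
have [_ /H h0 c0] := H _ he0.
case: t h0 c0 {H} => [|y t] //= [pt _ ct] c0.
rewrite /cyc_reduced /= rcons_path pcount_rcons -ct.
by move: pt => /andP[-> ->]; rewrite addnC.
Qed.

Lemma tau_conj w : exists g, tau (ev w) = ev (tau_cyc w) ^ g.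
Proof.
case: w => [|x s]; first by exists 1; rewrite ev_nil conjg1 /tau free_lift1.
exists (tau_offset x)^-1; have := tau_path_ev x (rcons s x).
by rewrite belast_rcons last_rcons => ->; rewrite conjgE invgK mulgA.
Qed.

Lemma count_a_tau_cyc w : count_a (tau_cyc w) = count_a w.
Proof. by case: w => // x s; rewrite /tau_cyc count_a_tau_path belast_rcons. Qed.

Lemma count_b_tau_cyc w : count_b (tau_cyc w) = ccount same w.
Proof. by case: w => // x s; rewrite /tau_cyc count_b_tau_path. Qed.

Lemma count_a_swap w : count_a (map (sperm_letter swap) w) = count_b w.
Proof. by rewrite /count_a count_map; apply: eq_count => -[[] ?]. Qed.

Lemma count_b_swap w : count_b (map (sperm_letter swap) w) = count_a w.
Proof. by rewrite /count_b count_map; apply: eq_count => -[[] ?]. Qed.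

Lemma pcount_map (f : rel (letter bool)) g x s :
  (forall p q, f (g p) (g q) = f p q) ->
  pcount f (g x) (map g s) = pcount f x s.
Proof. by move=> fg; elim: s x => //= y s IHs x; rewrite fg IHs. Qed.

Lemma ccount_swap f w :
  (forall p q, f (sperm_letter swap p) (sperm_letter swap q) = f p q) ->
  ccount f (map (sperm_letter swap) w) = ccount f w.
Proof. by case: w => //= x s h; rewrite -map_rcons pcount_map. Qed.

Lemma same_swap p q : same (sperm_letter swap p) (sperm_letter swap q) = same p q.
Proof. by case: p => [[] []]; case: q => [[] []]. Qed.

Lemma same_flip_swap p q :
  same_flip (sperm_letter swap p) (sperm_letter swap q) = same_flip p q.
Proof. by case: p => [[] []]; case: q => [[] []]. Qed.

Lemma positive_conj l u g : positive l (u ^ g) = positive l u ^ positive l g.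
Proof.
have m := @positive_morph l.
by rewrite !conjgE !m (morphV m).
Qed.

(** Since c + c' >= 2 max(x, y), the assumption c' < max(x, y) yields
    c > max(x, y); after tau the counts (x, c, y) thus satisfy the assumption
    again, and x + c > x + y. *)
Lemma positive_grow l w : cyc_reduced w ->
  ccount same_flip w < maxn (count_a w) (count_b w) ->
  exists w' g, [/\ cyc_reduced w', positive l (ev w) = ev w' ^ g & size w <= size w'].
Proof.
elim: l w => [|c l IHl] w cw J /=; first by exists w, 1; rewrite conjg1.
case: c => /=; last first.
  rewrite sperm_ev; have [||w' [g [cw' e le]]] := IHl (map (sperm_letter swap) w).
  - by rewrite sperm_cyc.
  - by rewrite count_a_swap count_b_swap maxnC ccount_swap //; apply: same_flip_swap.
  by exists w', g; split=> //; rewrite size_map in le.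
have [g0 ->] := tau_conj w; rewrite positive_conj.
have tw := cyc_turns cw; have [cw1 t1] := cyc_tau_cyc cw.
have [|w' [g [cw' -> le]]] := IHl _ cw1.
  by rewrite t1 count_a_tau_cyc count_b_tau_cyc; move: tw J; lia.
exists w', (g * positive l g0); rewrite conjgM; split=> //.
apply: leq_trans le; rewrite -!count_a_b count_a_tau_cyc count_b_tau_cyc; lia.
Qed.

(** Until the first tau only swaps occur, which keep c and max(x, y); that tau
    lengthens the word and brings it into the situation of [positive_grow]. *)
Lemma positive_grow_strict l w : cyc_reduced w -> true \in l ->
  maxn (count_a w) (count_b w) < ccount same w ->
  exists w' g, [/\ cyc_reduced w', positive l (ev w) = ev w' ^ g & size w < size w'].
Proof.
elim: l w => [|c l IHl] w cw //= lt B.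
case: c lt => /= lt; last first.
  rewrite sperm_ev; have [|||w' [g [cw' e le]]] := IHl (map (sperm_letter swap) w).
  - by rewrite sperm_cyc.
  - by rewrite inE in lt.
  - by rewrite count_a_swap count_b_swap maxnC ccount_swap //; apply: same_swap.
  by exists w', g; split=> //; rewrite size_map in le.
have [g0 ->] := tau_conj w; rewrite positive_conj.
have [cw1 t1] := cyc_tau_cyc cw.
have [|w' [g [cw' -> le]]] := positive_grow l cw1.
  by rewrite t1 count_a_tau_cyc count_b_tau_cyc; move: B; lia.
exists w', (g * positive l g0); rewrite conjgM; split=> //.
apply: leq_trans le; rewrite -!count_a_b count_a_tau_cyc count_b_tau_cyc; lia.
Qed.

End Growth.

(** * A normal form for automorphisms of the free group of rank two *)

Section Standard.
Implicit Types (u v g h : F2) (l : seq bool) (d : F2 -> F2).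

(** Since Out F(a, b) = GL_2(Z), this is the fact that an integral matrix of
    determinant 1 or -1 has, up to signs of rows and columns, nonnegative
    entries and is then a product of elementary nonnegative matrices. *)
Definition standard d := exists g p1 l p2,
  forall u, d u = sperm p1 (positive l (sperm p2 u)) ^ g.

Definition taui : F2 -> F2 :=
  free_lift (fun b : bool => if b then free_gen true else free_gen false / free_gen true).

Lemma taui_morph : morph taui. Proof. exact: free_lift_morph. Qed.

Lemma morph_comp d d' : morph d -> morph d' -> morph (fun u => d (d' u)).
Proof. by move=> md md' u v; rewrite md' md. Qed.

Lemma morph_conj d g : morph d -> morph (fun u => d u ^ g).
Proof. by move=> md u v; rewrite md conjMg. Qed.

Lemma standard_ext d d' : d =1 d' -> standard d -> standard d'.
Proof. by move=> e [g [p1 [l [p2 h]]]]; exists g, p1, l, p2 => u; rewrite -e. Qed.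

Lemma sperm_comp p q : exists r, forall u, sperm p (sperm q u) = sperm r u.
Proof.
exists (q.1 (+) p.1, (q.2.1 (+) (if q.1 then p.2.2 else p.2.1),
                      q.2.2 (+) (if q.1 then p.2.1 else p.2.2))) => u.
rewrite -[u]word_ofK !sperm_ev -map_comp; congr ev; apply: eq_map.
by case: p => [[] [[] []]]; case: q => [[] [[] []]] [[] []].
Qed.

Lemma sperm_id u : sperm (false, (false, false)) u = u.
Proof.
by rewrite -[u]word_ofK sperm_ev map_id_in // => -[[] []].
Qed.

Lemma sperm_invl p : exists q, forall u, sperm p (sperm q u) = u.
Proof.
exists (p.1, (if p.1 then (p.2.2, p.2.1) else p.2)) => u.
rewrite -{2}[u]word_ofK -[u in LHS]word_ofK !sperm_ev -map_comp map_id_in //.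
by case: p => [[] [[] []]] [[] []].
Qed.

Lemma standard_post d p g : standard d -> standard (fun u => sperm p (d u) ^ g).
Proof.
move=> [h [p1 [l [p2 e]]]]; have [r er] := sperm_comp p p1.
exists (sperm p h * g), r, l, p2 => u.
by rewrite e (morph_conjg _ _ (@sperm_morph p)) er conjgM.
Qed.

Lemma standard_conj d g : standard d -> standard (fun u => d u ^ g).
Proof.
move=> sd; apply: standard_ext (standard_post (false, (false, false)) g sd) => u.
by rewrite sperm_id.
Qed.

Lemma standard_sperm d p : standard d -> standard (fun u => d (sperm p u)).
Proof.
move=> [h [p1 [l [p2 e]]]]; have [r er] := sperm_comp p2 p.
by exists h, p1, l, r => u; rewrite e er.
Qed.

Lemma standard_of_sperm d p : standard (fun u => d (sperm p u)) -> standard d.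
Proof.
have [q qK] := sperm_invl p => /(@standard_sperm _ q); apply: standard_ext => u.
by rewrite qK.
Qed.

Lemma standard_of_conj d g : standard (fun u => d u ^ g) -> standard d.
Proof. by move=> /(@standard_conj _ g^-1); apply: standard_ext => u; rewrite conjgK. Qed.

Lemma standard_positive l : standard (positive l).
Proof.
exists 1, (false, (false, false)), l, (false, (false, false)) => u.
by rewrite !sperm_id conjg1.
Qed.

Lemma tau_genE : (tau (free_gen false) = free_gen false * free_gen true)
  * (tau (free_gen true) = free_gen true)
  * (taui (free_gen false) = free_gen false / free_gen true)
  * (taui (free_gen true) = free_gen true).
Proof. by rewrite /tau /taui !free_lift_gen. Qed.

Lemma sperm_genE p b : sperm p (free_gen b) =
  if (if b then p.2.2 else p.2.1) then (free_gen (b (+) p.1))^-1 else free_gen (b (+) p.1).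
Proof. by rewrite /sperm free_lift_gen /ev big_seq1; case: b; case: p => [? [[] []]]. Qed.

Let tauM := tau_morph.
Let tauV := morphV tau_morph.
Let tauiM := taui_morph.
Let tauiV := morphV taui_morph.
Let spM := sperm_morph.
Let spV p := morphV (@sperm_morph p).
Let evalE := (sperm_genE, tau_genE, tauM, tauV, tauiM, tauiV, spM, spV).

Lemma tauiE u :
  taui u = sperm (false, (false, true)) (tau (sperm (false, (false, true)) u)).
Proof.
have m2 := morph_comp (@sperm_morph (false, (false, true)))
  (morph_comp tau_morph (@sperm_morph (false, (false, true)))).
apply: (morph_ext taui_morph m2) => -[].
- by do 4!rewrite /= 9?evalE; rewrite 30?gnorm.
- by do 4!rewrite /= 9?evalE; rewrite 30?gnorm.
Qed.

Lemma tau_tauiK u : tau (taui u) = u.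
Proof.
apply: (morph_ext (morph_comp tau_morph taui_morph) (fun _ _ => erefl)) => -[].
  by rewrite !evalE.
by rewrite !evalE mulgK.
Qed.

(** The one case in which [taui] does not simply cancel: all that is left of it
    is a sign change. *)
Lemma tau_swap_taui u : tau (sperm swap (taui u)) =
  sperm swap (tau (sperm swap (sperm (false, (true, false)) u))) ^ (free_gen false)^-1.
Proof.
have m1 := morph_comp tau_morph (morph_comp (@sperm_morph swap) taui_morph).
have m2 := morph_conj (free_gen false)^-1 (morph_comp (@sperm_morph swap)
  (morph_comp tau_morph (morph_comp (@sperm_morph swap) (@sperm_morph (false, (true, false)))))).
apply: (morph_ext m1 m2) => -[].
- by rewrite conjgE; do 5!rewrite /= 9?evalE; rewrite 30?gnorm.
- by rewrite conjgE; do 5!rewrite /= 9?evalE; rewrite 30?gnorm.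
Qed.

(** Moving signs across tau turns it into its inverse exactly when the two signs
    differ. *)
Lemma sign_tau f0 f1 : exists h, forall u,
  sperm (false, (f0, f1)) (tau u) =
  (if f0 (+) f1 then taui else tau) (sperm (false, (f0, f1)) u) ^ h.
Proof.
pose h := if f0 then (if f1 then (free_gen true)^-1 else free_gen true) else 1 : F2.
have m1 := morph_comp (@sperm_morph (false, (f0, f1))) tau_morph.
have mt : morph (if f0 (+) f1 then taui else tau).
  by case: (_ (+) _); [apply: taui_morph | apply: tau_morph].
have m2 := morph_conj h (morph_comp mt (@sperm_morph (false, (f0, f1)))).
exists h; apply: (morph_ext m1 m2) => t; rewrite {m1 m2 mt}/h.
case: f0; case: f1; case: t; rewrite ?conjg1 ?conjgE; by do 4!rewrite /= 9?evalE; rewrite 30?gnorm.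
Qed.

(** Read the product from its right end: a tau there cancels [taui], two swaps
    cancel each other, and tau followed by a swap is treated by
    [tau_swap_taui]. *)
Lemma standard_positive_taui l : standard (fun u => positive l (taui u)).
Proof.
have [n] := ubnP (size l); elim: n l => // n IHn l; rewrite ltnS.
case: l => [_|[] l szl] /=.
- apply: standard_ext (standard_sperm (false, (false, true))
    (standard_post (false, (false, true)) 1 (standard_positive [:: true]))) => u /=.
  by rewrite conjg1 tauiE.
- by apply: standard_ext (standard_positive l) => u; rewrite tau_tauiK.
case: l szl => [_|[] l szl] /=.
- apply: standard_ext (standard_post swap 1 (standard_sperm (false, (false, true))
    (standard_post (false, (false, true)) 1 (standard_positive [:: true])))) => u /=.
  by rewrite !conjg1 tauiE.
- apply: standard_ext (standard_conj (positive l (free_gen false)^-1)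
    (standard_sperm (false, (true, false)) (standard_positive [:: false, true, false & l]))) => u /=.
  by rewrite tau_swap_taui positive_conj.
apply: standard_ext (IHn l _) => [u|]; last by apply: leq_trans szl => /=.
suff -> : sperm swap (sperm swap (taui u)) = taui u by [].
by rewrite -[taui u]word_ofK !sperm_ev -map_comp map_id_in // => -[[] []].
Qed.

Lemma positive_swap (b : bool) l u :
  positive (nseq b false ++ l) u = positive l (if b then sperm swap u else u).
Proof. by case: b. Qed.

Lemma sperm_swap_sign p u :
  sperm p u = if p.1 then sperm swap (sperm (false, p.2) u) else sperm (false, p.2) u.
Proof.
case: p => [[] f] //=; rewrite -[u]word_ofK !sperm_ev -map_comp; congr ev.
by apply: eq_map => -[[] s]; rewrite /sperm_letter /= ?addbF.
Qed.

(** The signs of the inner signed permutation are moved to the right of tau and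
    its swap is absorbed in the positive part. *)
Lemma standard_tau d : standard d -> standard (fun u => d (tau u)).
Proof.
move=> [g [p1 [l [[sw [f0 f1]] e]]]].
have [h eh] := sign_tau f0 f1; pose l' := nseq sw false ++ l.
have eq u : d (tau u) = sperm p1 (positive l' ((if f0 (+) f1 then taui else tau)
    (sperm (false, (f0, f1)) u))) ^ (sperm p1 (positive l' h) * g).
  rewrite conjgM -(morph_conjg _ _ (@sperm_morph p1)) -positive_conj -eh e.
  by rewrite /l' positive_swap [sperm (sw, _) _]sperm_swap_sign.
apply: (standard_ext (fun u => esym (eq u))); apply: standard_post.
apply: (@standard_sperm (fun u => positive l' ((if f0 (+) f1 then taui else tau) u))).
case: (_ (+) _); first exact: standard_positive_taui.
exact: (standard_positive (true :: l')).
Qed.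

Lemma standard_of_tau d : standard (fun u => d (tau u)) -> standard d.
Proof.
move=> sd; apply: standard_ext (standard_sperm (false, (false, true))
  (standard_tau (standard_sperm (false, (false, true)) sd))) => u /=.
rewrite -tauiE tau_tauiK //.
Qed.

End Standard.

(** * Nielsen reduction in rank two *)

Section Nielsen.
Variable d : F2 -> F2.
Hypothesis (md : morph d) (sd : forall g, exists u, d u = g).
Implicit Types (x y z : letter bool) (l : seq (letter bool)).

Definition image_of x : F2 := d (ev [:: x]).
Definition len x := size (word_of (image_of x)).

(** Minimality of the pair (d a, d b) up to signed permutations, conjugation and
    the moves (u, v) -> (uv, v). *)
Hypothesis dmin : forall x y g, x.1 != y.1 ->
  len x + len y <= size (word_of ((image_of x * image_of y) ^ g)) + size (word_of (image_of y ^ g)).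

Lemma image_inv x : image_of (letter_inv x) = (image_of x)^-1.
Proof. by rewrite /image_of ev_letter_inv morphV. Qed.

Lemma len_inv x : len (letter_inv x) = len x.
Proof. by rewrite /len image_inv word_of_inv size_word_inv. Qed.

Lemma image_gen (a : bool) : image_of (a, false) = d (free_gen a).
Proof. by rewrite /image_of /ev big_seq1. Qed.

(** If one of a, b had trivial image, the image of the other one would centralize
    the image of d, which is the whole group, and this would be abelian. *)
Lemma image_neq1 x : image_of x != 1.
Proof.
apply/eqP => x1; pose a := x.1.
have a1 : d (free_gen a) = 1.
  rewrite -image_gen /a; case: x x1 {a} => a [] //= x1.
  by rewrite -[(a, false)]letter_invK image_inv x1 invg1.
have fixall h : d (free_gen (~~ a)) ^ h = d (free_gen (~~ a)) -> forall g, g ^ h = g.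
  move=> hh g; have [u <-] := sd g.
  apply: (morph_ext (morph_conj h md) md) => b.
  have [->|] := eqVneq b a; first by rewrite a1 conj1g.
  by rewrite -[b]negbK; case: a hh {a1} (b) => hh [].
have comm : forall g, g ^ d (free_gen (~~ a)) = g.
  by apply: fixall; rewrite conjgE mulKg.
have /fixall /(_ (free_gen false)) : d (free_gen (~~ a)) ^ free_gen true = d (free_gen (~~ a)).
  by rewrite conjgE -{2}(comm (free_gen true)) -conjgC mulKg.
by move/(congr1 (@word_of _)).
Qed.

Lemma len_gt0 x : 0 < len x.
Proof.
rewrite lt0n; apply/eqP => /size0nil x0.
by have /eqP[] := image_neq1 x; rewrite -[image_of x]word_ofK x0 ev_nil.
Qed.

(** The number of letters cancelled in each factor of the product of the images. *)
Definition cancel_len x y :=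
  (len x + len y - size (word_of (image_of x * image_of y)))./2.

Lemma image_split x y : exists P Q R,
  [/\ word_of (image_of x) = P ++ Q, word_of (image_of y) = word_inv Q ++ R,
      word_of (image_of x * image_of y) = P ++ R & size Q = cancel_len x y].
Proof.
have [P [Q [R [eP eR e]]]] := mul_split (image_of x) (image_of y).
exists P, Q, R; split=> //.
by rewrite /cancel_len /len eP eR e !size_cat size_word_inv; lia.
Qed.

Lemma cancel_size x y :
  size (word_of (image_of x * image_of y)) + 2 * cancel_len x y = len x + len y.
Proof.
have [P [Q [R [eP eR e <-]]]] := image_split x y.
by rewrite /len eP eR e !size_cat size_word_inv; lia.
Qed.

Lemma cancel_sq x : 2 * cancel_len x x < len x.
Proof.
have lt : len x < size (word_of (image_of x * image_of x)) := size_sq (image_neq1 x).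
have := cancel_size x x; lia.
Qed.

Lemma compat_case x y : compat x y -> x = y \/ x.1 != y.1.
Proof. by case: x => [[] []]; case: y => [[] []]; auto. Qed.

(** For distinct generators this is minimality for the moves that replace one
    factor by the product. *)
Lemma cancel_half x y : compat x y ->
  2 * cancel_len x y <= len x /\ 2 * cancel_len x y <= len y.
Proof.
move=> /compat_case[->|xy]; first by have := cancel_sq y; split; lia.
have h := cancel_size x y; split.
  have yx : (letter_inv y).1 != (letter_inv x).1 by rewrite eq_sym.
  have := dmin 1 yx.
  have -> : image_of (letter_inv y) * image_of (letter_inv x) = (image_of x * image_of y)^-1.
    by rewrite !image_inv invgM.
  rewrite !conjg1 !len_inv image_inv.
  have sV (u : F2) : size (word_of u^-1) = size (word_of u) by apply: size_word_inv.
  rewrite !sV -/(len x); lia.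
have := dmin 1 xy; rewrite !conjg1 -/(len y); lia.
Qed.

(** Otherwise [image_of y] is cancelled entirely, half from the left and half from
    the right.  Were z inverse to x, the two halves would be inverse to each
    other; so z = x, and a conjugation brings the total length of the pair
    (image_of x * image_of y, image_of y) down to that of [image_of x]. *)
Lemma cancel_triple x y z : compat x y -> compat y z ->
  cancel_len x y + cancel_len y z < len y.
Proof.
move=> cxy cyz; rewrite ltnNge; apply/negP => big.
have [hx hy] := cancel_half cxy; have [hy' hz] := cancel_half cyz.
have lp := len_gt0 y.
have xy : x.1 != y.1.
  have [e|//] := compat_case cxy; have := cancel_sq y; rewrite e in big; lia.
have yz : y.1 != z.1.
  by have [e|//] := compat_case cyz; have := cancel_sq y; rewrite -e in big; lia.
have [P1 [Q1 [R1 [ex ey _ sQ1]]]] := image_split x y.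
have [P2 [Q2 [R2 [ey' ez _ sQ2]]]] := image_split y z.
have szy : len y = size Q1 + size Q2 by lia.
have szQ : size Q1 = size Q2 by lia.
have {}ey : word_of (image_of y) = word_inv Q1 ++ Q2.
  have : size P2 = size (word_inv Q1).
    by move: szy; rewrite /len ey' size_cat size_word_inv; lia.
  by move: ey'; rewrite ey => /eqP + sP; rewrite eqseq_cat // => /andP[_ /eqP ->].
have [zx|zx] : z = letter_inv x \/ z = x.
  by case: (x) xy => [[] []]; case: (y) yz => [[] []]; case: (z) => [[] []]; auto.
  have : word_of (image_of z) = word_inv Q1 ++ word_inv P1.
    by rewrite zx image_inv word_of_inv ex word_inv_cat.
  rewrite ez => /eqP; rewrite eqseq_cat ?size_word_inv // => /andP[/eqP eQ _].
  have /eqP[] := image_neq1 y.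
  by rewrite -[image_of y]word_ofK ey -eQ ev_cat ev_word_inv mulVg.
rewrite zx in ez hz.
have [m eP1] : exists m, P1 = word_inv Q2 ++ m.
  exists (drop (size Q2) P1); rewrite -[LHS](cat_take_drop (size Q2)); congr (_ ++ _).
  have szP : size Q2 <= size P1 by move: hx; rewrite /len ex size_cat; lia.
  move: ez; rewrite ex => /(congr1 (take (size Q2))).
  by rewrite takel_cat // take_size_cat // size_word_inv.
have := dmin (ev Q2)^-1 xy.
have -> : image_of x * image_of y = ev m ^ ev Q2.
  rewrite -[image_of x]word_ofK -[image_of y]word_ofK ex ey eP1 !ev_cat !ev_word_inv.
  by rewrite conjgE !mulgA mulgK.
have -> : image_of y = ((ev Q1)^-1 * ev Q2).
  by rewrite -[image_of y]word_ofK ey ev_cat ev_word_inv.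
rewrite conjgK conjgE invgK mulgK -ev_word_inv -ev_cat.
have := size_ev m; have := size_ev (Q2 ++ word_inv Q1).
rewrite size_cat size_word_inv.
have : len x = size Q2 + size m + size Q1.
  by rewrite /len ex eP1 !size_cat size_word_inv.
lia.
Qed.

(** The amount of [image_of x] cancelled by what follows x, which is 0 at the end
    of a word. *)
Definition head_cancel x l := if l is y :: _ then cancel_len x y else 0.

(** By [cancel_triple] every factor keeps a letter, which shields the factors
    before it from those after it. *)
Lemma image_path x l : path compat x l -> exists Q,
  word_of (d (ev (x :: l))) = take (len x - head_cancel x l) (word_of (image_of x)) ++ Q /\
  size l <= size Q.
Proof.
elim: l x => [|y l IHl] x /=.
  by exists [::]; rewrite subn0 take_size cats0.
move=> /andP[xy pl]; have [Q [eQ szQ]] := IHl _ pl.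
have lt : cancel_len x y + head_cancel y l < len y.
  case: l pl {IHl eQ szQ} => [_|z l /andP[yz _]] /=; last exact: cancel_triple.
  have := cancel_half xy; have := len_gt0 y; lia.
have [P [C [R [ex ey exy szC]]]] := image_split x y.
have eT : take (len y - head_cancel y l) (word_of (image_of y)) =
    word_inv C ++ take (len y - head_cancel y l - size C) R.
  by rewrite ey take_cat size_word_inv ifF //; apply/negbTE; lia.
have szR : len y = size C + size R by rewrite /len ey size_cat size_word_inv.
have : 0 < size (take (len y - head_cancel y l - size C) R).
  by rewrite size_take; case: ifP; lia.
rewrite eT in eQ.
case eR : (take _ R) eQ => [|r R'] // eQ _.
exists (r :: R' ++ Q); rewrite /= size_cat; split; last by lia.
have -> : take (len x - cancel_len x y) (word_of (image_of x)) = P.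
  by rewrite ex take_size_cat // /len ex size_cat -szC addnK.
rewrite ev_cons md -/(image_of x) -[d _]word_ofK eQ -[image_of x]word_ofK ex -ev_cat.
rewrite !ev_cat ev_word_inv !mulgA mulgK -mulgA -!ev_cat word_of_ev //.
apply: reduced_glue.
  have := word_ofP (image_of x * image_of y).
  rewrite exy -(cat_take_drop (len y - head_cancel y l - size C) R) eR.
  by rewrite catA => /reduced_cat[].
by have := word_ofP (d (ev (y :: l))); rewrite eQ -catA => /reduced_cat[].
Qed.

Lemma gen_image (a : bool) : exists x, image_of x = free_gen a.
Proof.
have [u du] := sd (free_gen a).
case eu : (word_of u) (word_ofP u) => [|x l] rl.
  by move: du; rewrite -[u]word_ofK eu ev_nil morph1.
have [Q [eQ szQ]] := image_path rl.
move: eQ; rewrite -eu word_ofK du => /(congr1 size).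
rewrite size_cat size_takel ?leq_subr //= => sz.
have hc : 2 * head_cancel x l <= len x.
  by case: l rl {eu szQ sz} => //= y l /andP[/cancel_half[]].
have := len_gt0 x.
case: l eu szQ {rl hc} sz (hc) => [eu _ _ _ _|y l _ /= szQ sz hc lp]; last by lia.
by exists x; rewrite /image_of -eu word_ofK.
Qed.

(** By [image_path] the image of a word of length n has length at least n, so the
    preimages of a and b are letters and d is a signed permutation up to
    precomposition. *)
Lemma standard_minimal : standard d.
Proof.
have [x ex] := gen_image false; have [y ey] := gen_image true.
have xy : x.1 != y.1.
  apply/eqP => e1; have [e|e] : y = x \/ y = letter_inv x.
  - by case: (x) e1 => [[] []]; case: (y) => [[] []]; auto.
  - by move: ey; rewrite e ex => /(congr1 (@word_of _)).
  - by move: ey; rewrite e image_inv ex => /(congr1 (@word_of _)).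
have [p [px py]] := exists_sperm xy.
apply: (@standard_of_sperm _ p); apply: standard_ext (standard_positive [::]).
have m := morph_comp md (@sperm_morph p).
suff : (fun u => d (sperm p u)) =1 id by move=> h u; rewrite h.
apply: (morph_ext m (fun _ _ => erefl)) => b.
rewrite /sperm free_lift_gen -/(image_of _).
by case: b; rewrite ?px ?py ?ex ?ey.
Qed.

End Nielsen.

(** Induction on the total length of the images of the generators: as long as the
    pair is not minimal, a move that preserves standardness shortens it. *)
Lemma standard_of_surj (d : F2 -> F2) :
  morph d -> (forall g, exists u, d u = g) -> standard d.
Proof.
have [n] := ubnP (len d (false, false) + len d (true, false)).
elim: n d => // n IHn d; rewrite ltnS => szn md sd.
have [dmin|/existsNP[x /existsNP[y /existsNP[g /not_implyP[xy /negP]]]]] :=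
  EM (forall x y g, x.1 != y.1 -> len d x + len d y <=
  size (word_of ((image_of d x * image_of d y) ^ g)) + size (word_of (image_of d y ^ g))).
  exact: standard_minimal.
rewrite -ltnNge => lt.
have [p [px py]] := exists_sperm xy.
apply: (@standard_of_sperm _ p); apply: (@standard_of_tau (fun u => d (sperm p u))).
apply: (@standard_of_conj _ g).
have m := morph_conj g (morph_comp (morph_comp md (@sperm_morph p)) tau_morph).
apply: IHn => //; last first.
  move=> h; have [u du] := sd (h ^ g^-1); have [q qK] := sperm_invl p.
  by exists (taui (sperm q u)); rewrite tau_tauiK qK du conjgKV.
have lenE : len d x + len d y = len d (false, false) + len d (true, false).
  have lb a b : len d (a, b) = len d (a, false).
    by case: b => //; rewrite -[RHS](len_inv md).
  case: (x) xy => [a b]; case: (y) => [a' b'] /=; rewrite !lb.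
  by case: a; case: a' => // _; rewrite addnC.
rewrite /len /image_of in lenE szn lt *.
apply: leq_trans szn; rewrite -lenE.
rewrite /len /image_of; apply: leq_trans lt; rewrite ltnS eq_leq //.
rewrite /ev !big_seq1 /letter_eval /= !tau_genE.
rewrite (sperm_morph p) md -!px -!py /sperm !free_lift_gen /ev !big_seq1.
by [].
Qed.

(** * A malcharacteristic subgroup of rank two *)

Section Theta.
Implicit Types (x y p q r : letter bool) (s t w c u : seq (letter bool))
  (sg : bool * (bool * bool)).

(** The images of a and b under [Theta].  All that matters is that they have the
    same length, that the blocks follow each other without cancellation
    ([path_block]), and that they pass the finite tests [block_balance] and
    [block_sync]. *)
Definition block_of (a : bool) : seq (letter bool) :=
  let A := (false, false) in let A' := (false, true) in
  let B := (true, false) in let B' := (true, true) in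
  if a then [:: B; A'; B'; B'; B'; A'; A'; A'; B]
  else [:: A; B; A'; B; B; B; B; A; A].

Definition block p := if p.2 then word_inv (block_of p.1) else block_of p.1.

Definition blocks w := flatten (map block w).

Definition Theta : F2 -> F2 := free_lift (fun b => ev (block_of b)).

Lemma Theta_morph : morph Theta. Proof. exact: free_lift_morph. Qed.

Lemma Theta_ev w : Theta (ev w) = ev (blocks w).
Proof.
rewrite /Theta lift_ev; elim: w => [|x w IHw]; first by rewrite big_nil ev_nil.
rewrite big_cons IHw /blocks /= ev_cat; congr (_ * _).
by case: x => a [] //=; rewrite /letter_eval /block /= ev_word_inv.
Qed.

Lemma size_block p : size (block p) = 9. Proof. by case: p => [[] []]. Qed.

Lemma size_blocks w : size (blocks w) = (9 * size w)%N.
Proof. by elim: w => //= p w IHw; rewrite size_cat IHw size_block mulnS. Qed.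

Lemma blocks_cons p w : blocks (p :: w) = block p ++ blocks w. Proof. by []. Qed.

Lemma blocks_cat s t : blocks (s ++ t) = blocks s ++ blocks t.
Proof. by rewrite /blocks map_cat flatten_cat. Qed.

Lemma blocks_pow n w : blocks (pow n w) = pow n (blocks w).
Proof. by elim: n => //= n IHn; rewrite [LHS]blocks_cat IHn. Qed.

Lemma path_block p q : compat p q ->
  path compat (last p (block p)) (block q) /\ last p (block p) = last q (block p).
Proof. by case: p => [[] []]; case: q => [[] []]. Qed.

Lemma path_blocks p s : path compat p s ->
  path compat (last p (block p)) (blocks s) /\
  last (last p (block p)) (blocks s) = last (last p s) (block (last p s)).
Proof.
elim: s p => //= q s IHs p /andP[/path_block[pq _] /IHs[ps es]].
have e x : last x (block q) = last q (block q) by case: (q) => [[] []].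
by rewrite cat_path last_cat e pq ps.
Qed.

Lemma cyc_blocks w : cyc_reduced w -> cyc_reduced (blocks w).
Proof.
case: w => // x s cw.
have pw : path compat (last x s) (x :: s).
  by move: cw; rewrite /cyc_reduced /= rcons_path andbC.
have [pb eb] := path_blocks pw.
by apply: (cyc_of_path (x := last (last x s) (block (last x s)))); rewrite eb.
Qed.

Lemma reduced_blocks w : reduced w -> reduced (blocks w).
Proof.
case: w => // x s /path_blocks[pb _].
rewrite /blocks /=; have : sorted compat (block x) by case: (x) => [[] []].
case eb : (block x) pb => [|y t] /= pb; last by rewrite cat_path pb => ->.
by case: (x) eb => [[] []].
Qed.

(** A word for which, whatever the signs, the first tau of a standard automorphism
    satisfies the assumption of [positive_grow_strict]. *)
Definition balanced w := forall sg,
  let w' := map (sperm_letter sg) w in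
  maxn (count_a w') (count_b w') < ccount same w'.

(** Counting pairs inside the blocks only makes the count superadditive, so that
    [balanced] can be checked block by block. *)
Definition icount f s := if s is x :: s' then pcount f x s' else 0.

Lemma icount_cat f s t : icount f s + icount f t <= icount f (s ++ t).
Proof.
case: s => // x s /=; rewrite pcount_cat leq_add2l.
by case: t => //= y t; apply: leq_addl.
Qed.

Lemma icount_le f s : icount f s <= ccount f s.
Proof. by case: s => //= x s; rewrite pcount_rcons leq_addr. Qed.

Lemma count_a_cat s t : count_a (s ++ t) = count_a s + count_a t. Proof. exact: count_cat. Qed.

Lemma count_b_cat s t : count_b (s ++ t) = count_b s + count_b t. Proof. exact: count_cat. Qed.

Lemma block_balance sg p :
  maxn (count_a (map (sperm_letter sg) (block p))) (count_b (map (sperm_letter sg) (block p)))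
    < icount same (map (sperm_letter sg) (block p)).
Proof. by case: sg => [[] [[] []]]; case: p => [[] []]. Qed.

Lemma balanced_blocks w : w != [::] -> balanced (blocks w).
Proof.
move=> w0 sg; apply: leq_trans (icount_le _ _).
suff : maxn (count_a (map (sperm_letter sg) (blocks w)))
      (count_b (map (sperm_letter sg) (blocks w))) + size w
    <= icount same (map (sperm_letter sg) (blocks w)).
  have : 0 < size w by rewrite lt0n size_eq0.
  lia.
have arith (a1 b1 a2 b2 n1 n2 k : nat) : maxn a1 b1 < n1 ->
  maxn a2 b2 + k <= n2 -> maxn (a1 + a2) (b1 + b2) + k.+1 <= n1 + n2 by lia.
elim: w {w0} => // p w IHw.
rewrite blocks_cons map_cat; apply: leq_trans (icount_cat _ _ _).
by rewrite !count_a_cat !count_b_cat; have := arith _ _ _ _ _ _ _ (block_balance sg p) IHw.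
Qed.

(** A finite test: 8 signed permutations, 4 letters p, 12 pairs q, r and 9 offsets. *)
Lemma block_sync sg p q r o : compat q r -> o < 9 ->
  take 9 (drop o (block q ++ block r)) = map (sperm_letter sg) (block p) ->
  o = 0 /\ sg = (false, (false, false)).
Proof.
pose L : seq (letter bool) := [seq (a, b) | a <- [:: false; true], b <- [:: false; true]].
pose S := [seq (a, b) | a <- [:: false; true], b <- L].
have memL x : x \in L by case: x => [[] []].
have memS (z : bool * (bool * bool)) : z \in S by case: z => [[] [[] []]].
have : all (fun g => all (fun p => all (fun q => all (fun r => compat q r ==>
  all (fun o => (take 9 (drop o (block q ++ block r)) == map (sperm_letter g) (block p)) ==>
    ((o == 0) && (g == (false, (false, false))))) (iota 0 9)) L) L) L) S.
  by vm_compute.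
move=> /allP/(_ sg (memS sg))/allP/(_ p (memL p))/allP/(_ q (memL q))/allP/(_ r (memL r)).
move=> /implyP h qr o9 e; move: (h qr) => /allP/(_ o).
by rewrite mem_iota e eqxx => /(_ o9)/andP[/eqP-> /eqP->].
Qed.

(** An occurrence of the block lies in two consecutive blocks of w; the length
    condition on t ensures that the second of these exists. *)
Lemma blocks_sync sg w p s t : reduced w -> 9 <= size t ->
  blocks w = s ++ map (sperm_letter sg) (block p) ++ t ->
  sg = (false, (false, false)) /\ exists w1 w2, w = w1 ++ w2 /\ s = blocks w1.
Proof.
move=> + t9; elim: w s => [|q w IHw] s rw e.
  by case: s e => //; case: (p) => [[] []].
have [s9|s9] := ltnP (size s) 9.
  (* Since t is long, w has a second letter. *)
  case: w {IHw} rw e => [|r w] rw e.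
    have := congr1 size e; rewrite size_blocks !size_cat size_map size_block /=.
    by move: t9; case: (size t) => // n _; rewrite addnCA !addnS.
  have qr : compat q r by move: rw => /= /andP[].
  have : take 9 (drop (size s) (block q ++ block r)) = map (sperm_letter sg) (block p).
    transitivity (take 9 (drop (size s) (blocks [:: q, r & w]))); last first.
      by rewrite e drop_size_cat // take_size_cat // size_map size_block.
    rewrite !blocks_cons catA [in RHS]drop_cat size_cat !size_block ifT; last by lia.
    rewrite take_cat size_drop size_cat !size_block ifT //; lia.
  move=> /(block_sync qr s9)[/size0nil s0 ->]; split=> //.
  by exists [::], [:: q, r & w].
have [] := IHw (drop 9 s) (reduced_behead rw).
  have := congr1 (drop 9) e; rewrite blocks_cons drop_size_cat ?size_block // => ->.
  rewrite drop_cat; case: ltnP => // h.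
  have e9 : size s = 9 by apply/eqP; rewrite eqn_leq h.
  by rewrite e9 subnn drop0 -e9 drop_size.
move=> -> [w1 [w2 [ew es]]]; split=> //.
exists (q :: w1), w2; rewrite ew; split=> //.
rewrite blocks_cons -es -[LHS](cat_take_drop 9); congr (_ ++ _).
have := congr1 (take 9) e; rewrite [in RHS]takel_cat // => <-.
by rewrite blocks_cons take_size_cat ?size_block.
Qed.

Lemma Theta_inj : injective Theta.
Proof.
move=> u v uv; apply: (mulIg v^-1); rewrite mulgV.
have : Theta (u * v^-1) = 1.
  by rewrite Theta_morph (morphV Theta_morph) uv mulgV.
set z := u * _; rewrite -[z]word_ofK Theta_ev => /(congr1 (@word_of _)).
rewrite word_of_ev; last by apply: reduced_blocks; apply: word_ofP.
move=> /(congr1 size); rewrite size_blocks; case: (word_of z) => // _.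
exact: ev_nil.
Qed.

(** The word [blocks c] is the subword to overlap; its first block is located by
    [blocks_sync], so that the prefix A in [pow_overlap] is a product of blocks. *)
Lemma sperm_Theta_conj sg c c' g : c != [::] -> cyc_reduced c -> cyc_reduced c' ->
  sperm sg (ev (blocks c)) ^ g = ev (blocks c') ->
  sg = (false, (false, false)) /\ exists h, g = Theta h.
Proof.
case: c => // p s _ cc cc'; set c := p :: s in cc *; rewrite sperm_ev => e.
have [||i [k [A [B [eA eg]]]]] := pow_overlap 2 _ _ (cyc_blocks cc') e.
- by rewrite -size_eq0 size_map size_blocks.
- by rewrite sperm_cyc cyc_blocks.
rewrite -blocks_pow in eA.
have [|||sg1 [w1 [w2 [_ eA1]]]] := @blocks_sync sg (pow k c') p A
    (map (sperm_letter sg) (blocks s) ++ map (sperm_letter sg) (blocks c) ++ B).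
- exact: reduced_pow.
- rewrite !size_cat !size_map !size_blocks /=; lia.
- by rewrite eA /pow /= cats0 /blocks /= map_cat -!catA.
split=> //; exists (ev c ^+ i * (ev w1)^-1).
move: eg; rewrite eA1 sg1 -Theta_ev -sperm_ev sperm_id -Theta_ev => eg.
apply: invg_inj; apply: (mulIg (Theta (ev c) ^+ i)); rewrite eg.
have TM := Theta_morph; have TV := morphV TM.
by rewrite TM TV invgM invgK -ev_pow !Theta_ev blocks_pow ev_pow mulgVK.
Qed.

End Theta.

Section MalTheta.
Implicit Types (c w : seq (letter bool)) (g h u : F2) (d : F2 -> F2).

Lemma positive_notau l : true \notin l -> exists p, forall u, positive l u = sperm p u.
Proof.
elim: l => [_|[] l IHl] //.
  by exists (false, (false, false)) => u; rewrite sperm_id.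
rewrite inE /= => /IHl[p ep]; have [q eq] := sperm_comp p swap.
by exists q => u /=; rewrite ep eq.
Qed.

(** The two cases are the absence and the presence of a tau in the positive part. *)
Lemma standard_dichotomy d : standard d ->
  (exists p g, forall u, d u = sperm p u ^ g) \/
  (forall w w' g, balanced w -> cyc_reduced w -> cyc_reduced w' ->
    d (ev w) ^ g = ev w' -> size w < size w').
Proof.
move=> [g [p1 [l [p2 e]]]]; have [lt|/positive_notau[p ep]] := boolP (true \in l); last first.
  have [q eq] := sperm_comp p p2; have [r er] := sperm_comp p1 q.
  by left; exists r, g => u; rewrite e ep eq er.
right=> w w' h bw cw cw'; rewrite e sperm_ev.
have [|w1 [g1 [cw1 -> lt1]]] := positive_grow_strict _ lt (bw p2); first by rewrite sperm_cyc.
rewrite (morph_conjg _ _ (@sperm_morph p1)) sperm_ev -!conjgM => /conj_size.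
by rewrite sperm_cyc => /(_ cw1 cw') ->; rewrite size_map; rewrite size_map in lt1.
Qed.

(** If d lengthened the cyclic word of [Theta h], its inverse would have to shorten
    one, which neither case of [standard_dichotomy] allows; hence d is a signed permutation up to conjugation, and
    [sperm_Theta_conj] applies. *)
Lemma Theta_mal d d' h h' : morph d -> morph d' -> cancel d d' -> cancel d' d ->
  d (Theta h) = Theta h' -> h != 1 ->
  exists g, forall u, d u = u ^ Theta g.
Proof.
move=> md md' dK d'K dh h1; have TM := Theta_morph; have TV := morphV TM.
have sd : standard d by apply: standard_of_surj => // g; exists (d' g).
have sd' : standard d' by apply: standard_of_surj => // g; exists (d g).
have [t [c [cc eh]]] := cyc_decomp_conj h.
have [t' [c' [cc' eh']]] := cyc_decomp_conj h'.
have c0 : c != [::] by apply: contraNneq h1 => c0; rewrite eh c0 ev_nil conj1g.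
have c0' : c' != [::].
  apply: contraNneq h1 => c0'; apply/eqP; apply: Theta_inj; apply: (can_inj dK).
  by rewrite dh eh' c0' ev_nil conj1g (morph1 TM) (morph1 md).
(* This s conjugates the image of the cyclic word of h to that of h'. *)
pose s := d (Theta t) * (Theta t')^-1.
have e : d (ev (blocks c)) ^ s = ev (blocks c').
  move: dh; rewrite eh eh' !(morph_conjg _ _ TM) (morph_conjg _ _ md) !Theta_ev.
  by rewrite /s conjgM => ->; rewrite conjgK.
have e' : d' (ev (blocks c')) ^ (d' s)^-1 = ev (blocks c).
  by rewrite -e (morph_conjg _ _ md') dK conjgK.
have cb := cyc_blocks cc; have cb' := cyc_blocks cc'.
have [[p [g eg]]|grow] := standard_dichotomy sd; last first.
  have lt := grow _ _ _ (balanced_blocks c0) cb cb' e.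
  have [[p [g eg]]|/(_ _ _ _ (balanced_blocks c0') cb' cb e')] := standard_dichotomy sd'.
    move: e'; rewrite eg sperm_ev -conjgM => /conj_size; rewrite sperm_cyc => /(_ cb' cb).
    by rewrite size_map => eq; rewrite eq ltnn in lt.
  by rewrite ltnNge (ltnW lt).
move: (e); rewrite eg -conjgM => /(sperm_Theta_conj c0 cc cc')[p1 [k ek]].
have {p1}eg u : d u = u ^ g by rewrite eg p1 sperm_id.
exists (t^-1 * k * t') => u; rewrite eg; congr (_ ^ _).
rewrite !TM TV -ek /s eg conjgE !mulgA.
by rewrite mulgVK mulgK mulVg mul1g.
Qed.

End MalTheta.

(** * Malnormal subgroups of countable rank *)

(** This is where base 3 enters: twice a power of 3 is less than the next one. *)
Lemma sum_pow3_lt i j k : i < k -> j < k -> expn 3 i + expn 3 j < expn 3 k.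
Proof.
move=> ik jk; have : 3 * expn 3 i <= expn 3 k by rewrite -expnS leq_exp2l.
have : 3 * expn 3 j <= expn 3 k by rewrite -expnS leq_exp2l.
have : 0 < expn 3 k by rewrite expn_gt0.
lia.
Qed.

Lemma pow3_sidon i j k l : i != j -> expn 3 i + expn 3 l = expn 3 k + expn 3 j ->
  i = k /\ j = l.
Proof.
move=> ij e.
have inj a b : expn 3 a = expn 3 b -> a = b by move=> /eqP; rewrite eqn_exp2l // => /eqP.
have nlt x y z t : expn 3 x + expn 3 y = expn 3 z + expn 3 t -> ~~ ((x < z) && (y < z)).
  by move=> e'; apply/negP => /andP[xz yz]; have := sum_pow3_lt xz yz; lia.
have h1 := nlt _ _ _ _ e; have h2 := nlt _ _ _ _ (etrans e (addnC _ _)).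
have h3 := nlt _ _ _ _ (esym e).
have h4 := nlt _ _ _ _ (etrans (esym e) (addnC _ _)).
have [ik|ik] := eqVneq i k; first by split=> //; apply: inj; rewrite -ik in e; lia.
have [jl|jl] := eqVneq j l.
  by case/eqP: ik; apply: inj; rewrite -jl in e; lia.
have [kl|kl] := eqVneq k l; last by lia.
by case/eqP: ij; apply: inj; rewrite -kl in e; lia.
Qed.

Section Malnormal.
Variables (I : choiceType) (iota : I -> nat).
Hypothesis iota_inj : injective iota.
Implicit Types (p q x y : letter I) (s t c : seq (letter I)).

(** Distinct letters, including inverse ones, get distinct powers of 3. *)
Definition height p : nat := expn 3 (2 * iota p.1 + p.2).

Let a : F2 := free_gen false.
Let b : F2 := free_gen true.

(** The letter p, of either sign s, is sent to
    a^(height p) b^s a^(- height p^-1); this symmetry under inversion makes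
    all cases below uniform. *)
Definition psi : free_group I -> F2 :=
  free_lift (fun i => a ^+ height (i, false) * b * a ^- height (i, true)).

Lemma psi_morph : morph psi. Proof. exact: free_lift_morph. Qed.

Definition mark p : letter bool := (true, p.2).

(** The reduced word of a^(n - m); one of the two truncated differences is 0. *)
Definition run m n : seq (letter bool) :=
  nseq (n - m) (false, false) ++ nseq (m - n) (false, true).

(** The reduced form of the image of a word, up to powers of a at its ends. *)
Fixpoint enc p s := if s is q :: s' then
  mark p :: run (height (letter_inv p)) (height q) ++ enc q s' else [::].

Lemma psi1 p : psi (ev [:: p]) =
  a ^+ height p * ev [:: mark p] * a ^- height (letter_inv p).
Proof.
rewrite /psi lift_ev big_seq1 /ev big_seq1 /letter_eval /mark.
by case: p => i [] //=; rewrite !invgM invgK mulgA.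
Qed.

Lemma ev_nseq n : ev (nseq n (false, false)) = a ^+ n /\
  ev (nseq n (false, true)) = a ^- n.
Proof.
elim: n => [|n [e1 e2]] /=; first by rewrite ev_nil invg1.
split; first by rewrite ev_cons e1 expgS /ev big_seq1.
by rewrite ev_cons e2 expgSr invgM /ev big_seq1.
Qed.

Lemma ev_run m n : ev (run m n) = a ^- m * a ^+ n.
Proof.
rewrite /run ev_cat !(ev_nseq _).1 !(ev_nseq _).2.
have [le|/ltnW le] := leqP m n.
  rewrite (eqP le) invg1 mulg1; apply: (mulgI (a ^+ m)).
  by rewrite mulVKg -expgnDr subnKC.
rewrite (eqP le) mul1g; apply: (mulIg (a ^- n)).
by rewrite mulgK -invgM -expgnDr subnKC.
Qed.

Lemma psi_enc p s : psi (ev (belast p s)) =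
  a ^+ height p * ev (enc p s) * a ^- height (last p s).
Proof.
elim: s p => [|q s IHs] p /=.
  by rewrite !ev_nil mulg1 mulgV (morph1 psi_morph).
rewrite ev_cons psi_morph IHs -[mark p :: _]cat1s 2!ev_cat ev_run psi1.
by rewrite !mulgA.
Qed.

Lemma height_eq p q : height p = height q -> p = q.
Proof.
move=> /eqP; rewrite eqn_exp2l // => /eqP.
case: p => i e; case: q => j f /= h.
have ef : e = f by case: e h; case: f => /=; lia.
rewrite ef in h *; congr (_, _); apply: iota_inj; lia.
Qed.

Lemma run_all m n : all (fun x : letter bool => ~~ x.1) (run m n).
Proof. by rewrite all_cat !all_nseq /= !orbT. Qed.

Lemma run_path m n e : m != n -> path compat (true, e) (run m n) /\
  ~~ (last (true, e) (run m n)).1.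
Proof.
have pn k f e' : path compat (e', f) (nseq k (false, f)) /\
    (last (e', f) (nseq k (false, f))).1 = e' && (k == 0).
  have cf h : compat (h, f) (false, f) by case: (f); case: h.
  elim: k e' => [|k IHk] h; first by rewrite andbT.
  by rewrite /= cf; have [-> ->] := IHk false; rewrite andbF.
have pn' k f : path compat (true, e) (nseq k.+1 (false, f)) /\
    ~~ (last (true, e) (nseq k.+1 (false, f))).1.
  by have [/= pf lf] := pn k f false; rewrite /= pf lf.
rewrite neq_ltn /run => /orP[] lt; rewrite (eqP (ltnW lt)) ?cats0 ?cat0s.
  by rewrite -(subnSK lt).
by rewrite -(subnSK lt).
Qed.

(** No power of a between two letters b vanishes, because heights of different
    letters differ. *)
Lemma enc_path e p s : ~~ e.1 -> path compat p s ->
  path compat e (enc p s) /\ ~~ (last e (enc p s)).1.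
Proof.
elim: s e p => [|q s IHs] e p //= ne /andP[pq ps].
have neq : height (letter_inv p) != height q.
  by apply: contra pq => /eqP /height_eq ->.
have [pr lr] : path compat (mark p) (run (height (letter_inv p)) (height q)) /\
  ~~ (last (mark p) (run (height (letter_inv p)) (height q))).1 := run_path p.2 neq.
have [pe le] := IHs _ _ lr ps.
rewrite cat_path pr pe [last _ (_ ++ enc q s)]last_cat le; split=> //.
by case: (e) ne => [[] f].
Qed.

Definition cenc c := if c is x :: s then enc x (rcons s x) else [::].

Lemma cyc_cenc c : cyc_reduced c -> cyc_reduced (cenc c).
Proof.
case: c => // x s cc; apply: (cyc_of_path (x := last (false, false) (cenc (x :: s)))).
have [_ l1] := enc_path (e := (false, false)) isT cc.
have [+ _] := enc_path l1 cc.
by rewrite /cenc; case: (s).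
Qed.

Lemma psi_cenc x s : ev (cenc (x :: s)) = psi (ev (x :: s)) ^ (a ^+ height x).
Proof.
have := psi_enc x (rcons s x); rewrite belast_rcons last_rcons => ->.
by rewrite conjgE mulgVK mulKg.
Qed.

(** Letters b, here m, mark the ends of the runs of letters a. *)
Lemma marks_prefix (r s t u : seq (letter bool)) (m : letter bool) :
  all (fun x : letter bool => ~~ x.1) r -> m.1 ->
  s ++ m :: t = r ++ u -> exists v, s = r ++ v /\ v ++ m :: t = u.
Proof.
move=> + m1; elim: r s => [|x r IHr] s /=; first by exists s.
move=> /andP[nx nr]; case: s => [[mx _]|y s [-> /(IHr _ nr)[s' [-> <-]]]].
  by rewrite -mx m1 in nx.
by exists s'.
Qed.

Lemma run_inj m n m' n' : run m n = run m' n' -> n + m' = n' + m.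
Proof.
move=> e; have := congr1 (count_mem (false, false)) e.
have := congr1 (count_mem (false, true)) e.
rewrite /run !count_cat !count_nseq /= !mul0n !mul1n !addn0 !add0n; lia.
Qed.

(** A run between two letters b determines the letters on both sides of it. *)
Lemma height_sidon q r p p' : compat q r ->
  height r + height (letter_inv p) = height p' + height (letter_inv q) ->
  r = p' /\ letter_inv q = letter_inv p.
Proof.
move=> qr e.
have hN : height r != height (letter_inv q).
  by apply: contra qr => /eqP /height_eq ->.
have [|h1 h2] := pow3_sidon _ e; first by apply: contra hN => /eqP h; rewrite /height h.
by split; apply: height_eq; rewrite /height; [rewrite h1|rewrite h2].
Qed.

(** The runs of a word are separated by the letters b, so the run in the middle
    is one of the runs of [enc p s], and it is produced by the letters q and r
    only. *)
Lemma enc_sync p s q r (w t : seq (letter bool)) e f : path compat p s -> compat q r ->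
  enc p s = w ++ (true, e) :: run (height (letter_inv q)) (height r) ++ (true, f) :: t ->
  exists s1 s2, [/\ s = s1 ++ s2, w = enc p s1 & last p s1 = q].
Proof.
move=> + qr; elim: s p w => [|p' s IHs] p w /=; first by case: w.
move=> /andP[pp' ps]; case: w => [|y w] [] => [_ eq|ey eq].
  have [u [er eu]] := marks_prefix (run_all _ _) (isT : (true, f).1) (esym eq).
  have u0 : u = [::].
    case: u er eu => // z u er; case: s {IHs ps eq} => //= q' s [ez _].
    by have := run_all (height (letter_inv q)) (height r); rewrite er all_cat ez /= andbF.
  rewrite u0 cats0 in er; move: (run_inj er) => eh.
  exists [::], (p' :: s); split=> //=.
  by have [_ /(can_inj (@letter_invK _))] := height_sidon qr eh.
have [u [ew eu]] := marks_prefix (run_all _ _) (isT : (true, e).1) (esym eq).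
have [s1 [s2 [-> es1 ls1]]] := IHs _ _ ps (esym eu).
by exists (p' :: s1), s2; rewrite /= ew es1 -ey.
Qed.

Lemma enc_cat p s s' : enc p (s ++ s') = enc p s ++ enc (last p s) s'.
Proof. by elim: s p => //= q s IHs p; rewrite IHs -catA. Qed.

Lemma pow_cenc n x s : pow n (cenc (x :: s)) = enc x (pow n (rcons s x)) /\
  last x (pow n (rcons s x)) = x.
Proof.
elim: n => // n [IHn ln]; rewrite /pow /= -!/(pow n _) IHn enc_cat last_cat last_rcons.
by split.
Qed.

Lemma path_pow n x s : cyc_reduced (x :: s) -> path compat x (pow n (rcons s x)).
Proof.
move=> cc; elim: n => // n IHn; rewrite /pow /= -/(pow n _) cat_path last_rcons IHn.
by rewrite andbT.
Qed.

(** The overlap is longer than two letters of c; it contains the run after the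
    first letter x, and [enc_sync] finds the same x at the corresponding place
    in a power of c'. *)
Lemma psi_conj c c' g : c != [::] -> c' != [::] -> cyc_reduced c -> cyc_reduced c' ->
  psi (ev c) ^ g = psi (ev c') -> exists h, g = psi h.
Proof.
case: c => // x s; case: c' => // x' s' _ _ cc cc' e.
pose g0 := a ^- height x * g * a ^+ height x'.
have e0 : ev (cenc (x :: s)) ^ g0 = ev (cenc (x' :: s')).
  by rewrite !psi_cenc -e -!conjgM /g0 !mulgA mulgV mul1g.
have nc : cenc (x :: s) != [::] by rewrite /cenc; case: (s).
have [i [k [A [B [eA eg]]]]] := pow_overlap 2 nc (cyc_cenc cc) (cyc_cenc cc') e0.
have [q [r [t [es xq]]]] : exists q r t, pow 2 (rcons s x) = [:: q, r & t] /\ compat x q.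
  case: (s) cc => [|q t] /= /andP[xq _].
    by exists x, x, [::].
  case: t => [|r t]; first by exists q, x, [:: q; x].
  by eexists q, r, _; split; first reflexivity.
rewrite (pow_cenc 2 x s).1 es (pow_cenc k x' s').1 /= -catA in eA.
have [s1 [s2 [_ eA1 ls1]]] := enc_sync (path_pow k cc') xq eA.
move: eg; rewrite eA1 psi_cenc.
have -> : ev (enc x' s1) = a ^- height x' * psi (ev (belast x' s1)) * a ^+ height x.
  by rewrite psi_enc ls1 !mulgA mulgVK mulVg mul1g.
rewrite -conjXg conjgE /g0 !invgM invgK !mulgA mulgK => /mulIg.
rewrite -!mulgA => /mulgI eq.
exists (ev (x :: s) ^+ i * (ev (belast x' s1))^-1).
rewrite psi_morph (morphV psi_morph) (morphX _ psi_morph) -eq invgM invgK.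
by rewrite mulVKg.
Qed.

(** A nontrivial element is conjugate to a nonempty cyclically reduced word, whose
    encoding is reduced and not empty. *)
Lemma psi_inj : injective psi.
Proof.
move=> u v uv; apply: (mulIg v^-1); rewrite mulgV.
have : psi (u * v^-1) = 1.
  by rewrite psi_morph (morphV psi_morph) uv mulgV.
have [g [c [cc ->]]] := cyc_decomp_conj (u * v^-1).
case: c cc => [|x s] cc; first by rewrite ev_nil conj1g.
rewrite (morph_conjg _ _ psi_morph) => /eqP; rewrite conjg_eq1.
rewrite -(conjg_eq1 _ (a ^+ height x)) -psi_cenc => /eqP/(congr1 (@word_of _)).
rewrite word_of_ev; last by apply: cyc_reduced_reduced; apply: cyc_cenc.
by case: (s).
Qed.

Lemma psi_malnormal u v g : u != 1 -> psi u ^ g = psi v -> exists h, g = psi h.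
Proof.
move=> u1 e; have pM := psi_morph; have pV := morphV pM.
have v1 : v != 1.
  apply: contraNneq u1 => v1; move/eqP: e.
  by rewrite v1 (morph1 pM) conjg_eq1 -(morph1 pM) => /eqP/psi_inj ->.
have [t [c [cc eu]]] := cyc_decomp_conj u.
have [t' [c' [cc' ev']]] := cyc_decomp_conj v.
have c0 : c != [::] by apply: contraNneq u1 => c0; rewrite eu c0 ev_nil conj1g.
have c0' : c' != [::] by apply: contraNneq v1 => c0'; rewrite ev' c0' ev_nil conj1g.
have [|h eh] := psi_conj (g := psi t * g * (psi t')^-1) c0 c0' cc cc'.
  rewrite 2!conjgM -(morph_conjg _ _ pM) -eu e ev' (morph_conjg _ _ pM).
  by rewrite conjgK.
exists (t^-1 * h * t').
by rewrite !pM pV -eh !mulgA mulVg mul1g mulgVK.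
Qed.

End Malnormal.

(** * Malcharacteristic subgroups of prescribed rank *)

Lemma range_subgroup (H G : groupType) (f : H -> G) :
  {morph f : x y / x * y} -> subgroup (range f).
Proof.
move=> fM.
have f1 : f 1 = 1 by apply: (mulgI (f 1)); rewrite -fM !mulg1.
have fV x : f x^-1 = (f x)^-1 by apply: (mulgI (f x)); rewrite -fM !mulgV.
split; first by rewrite inE; exists 1.
move=> _ _ /[!inE] -[x _ <-] [y _ <-].
by exists (x * y^-1) => //; rewrite fM fV.
Qed.

(** The image of [psi] is malnormal in F(a, b), so its image under [Theta] is
    malnormal in the image of [Theta]. *)
Lemma malcharacteristic_free_basis (I : choiceType) (iota : I -> nat) :
  injective iota ->
  exists L : set F2, malcharacteristic L /\ exists x : I -> F2, free_basis x L.
Proof.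
move=> iI; pose f u := Theta (psi iota u).
have fM : {morph f : u v / u * v} by move=> u v; rewrite /f psi_morph Theta_morph.
exists (range f); split; last first.
  exists (fun i => f (free_gen i)).
  have fE : free_lift (fun i => f (free_gen i)) = f.
    apply: funext; apply: (morph_ext (@free_lift_morph _ _ _) fM) => i.
    by rewrite free_lift_gen.
  rewrite /free_basis fE; split.
  - by move=> u _; exists u.
  - by move=> u v _ _ /Theta_inj/(psi_inj iI).
  - by move=> _ [u _ <-]; exists u.
split; first exact: range_subgroup.
move=> d [d' dK d'K] nt.
have [z [[_ [u _ <-] dz] [v _ ez] z1]] : exists z,
    [/\ (d @` range f)%classic z, range f z & z <> 1].
  apply: contrapT => no; apply: nt; apply/seteqP; split=> z /=.
    by move=> [zd zf]; apply: contrapT => z1; apply: no; exists z.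
  move=> ->; have f1 : f 1 = 1 by apply: (mulgI (f 1)); rewrite -fM !mulg1.
  by split; [exists (f 1); [exists 1 | rewrite f1 gmulf1] | exists 1].
rewrite -{}ez in dz z1.
have u1 : u != 1.
  apply/eqP => u1; apply: z1; rewrite -dz u1 /f (morph1 (@psi_morph _ _)).
  by rewrite (morph1 Theta_morph) gmulf1.
have md : morph d by move=> x y; rewrite gmulfM.
have md' : morph d' by apply: can2_gmulfM dK d'K.
have p1 : psi iota u != 1.
  apply: contra u1 => /eqP h; apply/eqP; apply: (psi_inj iI).
  by rewrite h (morph1 (@psi_morph _ _)).
have [g dg] := Theta_mal md md' dK d'K dz p1.
move: dz; rewrite dg -(morph_conjg _ _ Theta_morph) => /Theta_inj.
move=> /(psi_malnormal iI u1)[h eg].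
exists (f h); first by exists h.
by apply: funext => x; rewrite dg eg.
Qed.

Theorem proposition5p4 (n : option nat) (hn : n <> Some 0) :
  exists L : set F2, malcharacteristic L /\ has_rank L n.
Proof.
case: n hn => [k|] _.
  exact: (malcharacteristic_free_basis (@ord_inj k)).
exact: (malcharacteristic_free_basis (fun i j : nat => id)).
Qed.
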